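(* Let $n\geq 4$ be an integer that is not a prime, and let $d_1,\ldots,d_k$ be the distinct proper divisors of $n$. For $1\leq i\leq k$, let $\Gamma(A_{d_i})$ be the induced subgraph of $\Gamma(\mathbb{Z}_n)$ on the vertex set $A_{d_i}=\{x\in\mathbb{Z}_n:(x,n)=d_i\}$. Then $$\Gamma(\mathbb{Z}_n)=\Upsilon_n[\Gamma(A_{d_1}),\Gamma(A_{d_2}),\ldots,\Gamma(A_{d_k})].$$
   Context: Elements of $\mathbb{Z}_n$ are written $0,1,\ldots,n-1$, and $(s,t)$ denotes the greatest common divisor. The zero divisor graph $\Gamma(\mathbb{Z}_n)$ is the simple graph whose vertices are the nonzero zero divisors of $\mathbb{Z}_n$ (nonzero $x$ such that $xy=0$ for some nonzero $y$), two distinct vertices $x,y$ being adjacent iff $xy=0$ in $\mathbb{Z}_n$. A proper divisor of $n$ is an integer $d$ with $1<d<n$ and $d\mid n$. $\Upsilon_n$ is the simple graph with vertices $d_1,\ldots,d_k$, two distinct vertices $d_i,d_j$ being adjacent iff $n\mid d_id_j$. For a graph $G$ with vertices $v_1,\ldots,v_k$ and pairwise disjoint graphs $H_1,\ldots,H_k$, the $G$-generalized join graph $G[H_1,\ldots,H_k]$ is the graph formed by replacing each vertex $v_i$ of $G$ by the graph $H_i$ and joining each vertex of $H_i$ to every vertex of $H_j$ whenever $v_i\sim v_j$ in $G$. In $\Upsilon_n[\Gamma(A_{d_1}),\ldots,\Gamma(A_{d_k})]$ the vertex $d_i$ is replaced by $\Gamma(A_{d_i})$. *)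

(* Defs.v *)
From mathcomp Require Import all_boot all_order all_algebra.

Set Implicit Arguments.
Unset Strict Implicit.
Unset Printing Implicit Defensive.

Import GRing.Theory.
Local Open Scope ring_scope.

(* A finite simple graph whose vertices are taken in an ambient finite type.  *)
(* The well-formedness condition is boolean, hence proof-irrelevant, so that  *)
(* Leibniz equality of graphs is equality of the vertex and edge sets.        *)
Record sgraph (T : finType) := SGraph {
  vertices : {set T};
  edges : {set {set T}};
  edgesP : [forall e in edges, (e \subset vertices) && (#|e| == 2%N)]
}.

Definition adj (T : finType) (G : sgraph T) (x y : T) : bool :=
  [set x; y] \in edges G.

(* The relation is only used off the diagonal and is meant to be symmetric.   *)
Section GraphOf.
Variables (T : finType) (V : {set T}) (r : rel T).

Definition edges_of : {set {set T}} :=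
  [set [set x; y] | x in V, y in V & (x != y) && r x y].

Fact edges_ofP :
  [forall e in edges_of, (e \subset V) && (#|e| == 2%N)].
Proof.
apply/forall_inP => e /imset2P[x y Vx]; rewrite inE => /and3P[Vy xy _] ->.
by rewrite subUset !sub1set Vx Vy cards2 xy.
Qed.

Definition graph_of : sgraph T := SGraph edges_ofP.
End GraphOf.

(* Meant for A \subset vertices G.                                            *)
Section Induced.
Variables (T : finType) (G : sgraph T) (A : {set T}).

Definition induced_edges : {set {set T}} := [set e in edges G | e \subset A].

Fact induced_edgesP :
  [forall e in induced_edges, (e \subset A) && (#|e| == 2%N)].
Proof.
apply/forall_inP => e; rewrite inE => /andP[Ge ->] /=.
by case/andP: (forall_inP (edgesP G) e Ge).
Qed.

Definition induced : sgraph T := SGraph induced_edgesP.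
End Induced.

Definition disjoint_family (I T : finType) (V : {set I}) (H : I -> sgraph T) :=
  {in V &, forall i j, i != j -> [disjoint vertices (H i) & vertices (H j)]}.

(* The family H is indexed by the vertices of G, i.e. v is replaced by H v;   *)
(* the values of H outside vertices G are not used.                           *)
Section GeneralizedJoin.
Variables (I T : finType) (G : sgraph I) (H : I -> sgraph T).
Hypothesis disjH : disjoint_family (vertices G) H.

Definition gjoin_vertices : {set T} :=
  \bigcup_(i in vertices G) vertices (H i).

Definition gjoin_edges : {set {set T}} :=
  (\bigcup_(i in vertices G) edges (H i)) :|:
  (\bigcup_(i in vertices G) \bigcup_(j in vertices G | adj G i j)
     [set [set x; y] | x in vertices (H i), y in vertices (H j)]).

Fact gjoin_edgesP :
  [forall e in gjoin_edges, (e \subset gjoin_vertices) && (#|e| == 2%N)].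
Proof.
apply/forall_inP => e; rewrite inE => /orP[] /bigcupP[i Gi].
  move=> He; case/andP: (forall_inP (edgesP (H i)) e He) => sub ->.
  by rewrite andbT (subset_trans sub) // (bigcup_sup i).
case/bigcupP=> j /andP[Gj ij] /imset2P[x y Hx Hy ->].
have i'j : i != j.
  apply: contraTneq ij => ->; apply/negP => ejj.
  by case/andP: (forall_inP (edgesP G) _ ejj) => _; rewrite setUid cards1.
have xy : x != y.
  apply: contraTneq Hy => <-.
  by rewrite (disjointFr (disjH Gi Gj i'j) Hx).
rewrite subUset !sub1set cards2 xy andbT.
by apply/andP; split; apply/bigcupP; [exists i | exists j].
Qed.

Definition gjoin : sgraph T := SGraph gjoin_edgesP.
End GeneralizedJoin.
Arguments gjoin {I T} G H disjH.

Definition zero_divisor_graph (R : finComNzRingType) : sgraph R :=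
  graph_of [set x : R | (x != 0) && [exists y : R, (y != 0) && (x * y == 0)]]
           (fun x y => x * y == 0).

(* Every proper divisor of n is smaller than n, so 'I_n is large enough to    *)
(* host the vertices; the product below is taken in nat.                      *)
Definition upsilon (n : nat) : sgraph 'I_n :=
  graph_of [set d : 'I_n | (1 < d)%N && (d %| n)%N]
           (fun d e => (n %| d * e)%N).

(* 'Z_n is the ring of integers mod n only for 1 < n.                         *)
Definition gcd_class (n d : nat) : {set 'Z_n} := [set x : 'Z_n | gcdn x n == d].

Fact gcd_class_disjoint (n : nat) :
  disjoint_family (vertices (upsilon n))
    (fun d : 'I_n => induced (zero_divisor_graph 'Z_n) (gcd_class n d)).
Proof.
move=> i j _ _ ij; rewrite -setI_eq0; apply/eqP/setP => x; rewrite !inE /=.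
by apply: contraNF ij => /andP[/eqP ix /eqP jx]; rewrite -val_eqE /= -ix -jx.
Qed.
Arguments gcd_class_disjoint : clear implicits.

(* Main.v *)
(* Since gcd(x, n) gcd(y, n) is the gcd of xy, xn, yn and n^2, it is divisible
   by n iff xy is, so adjacency in the zero divisor graph depends only on the
   gcd classes of the endpoints, through the relation defining [upsilon n].
   The vertices are exactly the x such that gcd(x, n) is a proper divisor of n:
   such an x is annihilated by n / gcd(x, n). *)
Require Import Defs.
From mathcomp Require Import all_boot all_order all_algebra.

Set Implicit Arguments.
Unset Strict Implicit.
Unset Printing Implicit Defensive.

Import GRing.Theory.

Lemma sgraph_eq (T : finType) (G H : sgraph T) :
  vertices G = vertices H -> edges G = edges H -> G = H.
Proof.
case: G H => [V E pE] [W F pF] /= eVW eEF; case: W / eVW pF => pF.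
by case: F / eEF pF => pF; rewrite (bool_irrelevance pE pF).
Qed.

(** An unordered pair determines its endpoints only up to a swap, which the symmetry of [r] absorbs;
    comparing cardinals gives [x != y]. *)
Lemma adj_graph_of (T : finType) (V : {set T}) (r : rel T) (x y : T) :
  symmetric r ->
  adj (graph_of V r) x y = [&& x \in V, y \in V, x != y & r x y].
Proof.
move=> r_sym; apply/imset2P/and4P => [[a b Va]|[Vx Vy xy rxy]]; last first.
  by exists x y; rewrite // inE Vy xy rxy.
rewrite inE => /and3P[Vb ab rab] exy.
have xab : x \in [set a; b] by rewrite -exy set21.
have yab : y \in [set a; b] by rewrite -exy set22.
have xy : x != y.
  by have := cards2 a b; rewrite -exy cards2 ab; case: (x != y).
by case/set2P: xab xy => ->; case/set2P: yab => ->; rewrite ?eqxx // => xy;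
  split=> //; rewrite r_sym.
Qed.

Lemma dvdn_mul_gcd (n x y : nat) : (n %| gcdn x n * gcdn y n) = (n %| x * y).
Proof.
rewrite muln_gcdr dvdn_gcd (dvdn_mull _ (dvdnn n)) andbT.
by rewrite muln_gcdl dvdn_gcd (dvdn_mulr _ (dvdnn n)) andbT.
Qed.

Lemma Zp_mul_eq0 (n : nat) (x y : 'Z_n) : 1 < n ->
  (x * y == 0)%R = (n %| gcdn x n * gcdn y n).
(* Once [n] has two visible successors, the modulus of ['Z_n] computes to [n], and vanishing of the
   product is divisibility by conversion. *)
Proof. by case: n x y => [|[|n]] x y // _; rewrite dvdn_mul_gcd. Qed.

Lemma zero_divisor_graph_Zp_vertices (n : nat) (x : 'Z_n) : 1 < n ->
  (x \in vertices (zero_divisor_graph 'Z_n)) = (1 < gcdn x n < n).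
Proof.
move=> n_gt1; have n_gt0 := ltnW n_gt1.
have ltn (z : 'Z_n) : z < n by rewrite -[ltnRHS](Zp_cast n_gt1).
have neq0 (z : 'Z_n) : (z != 0)%R = (0 < z) by rewrite lt0n.
have gcd_lt (z : 'Z_n) : (gcdn z n < n) = (0 < z).
  have [z0|z_gt0] := posnP z; first by rewrite z0 gcd0n ltnn.
  exact: leq_ltn_trans (dvdn_leq z_gt0 (dvdn_gcdl z n)) (ltn z).
(* The upper bound encodes [x != 0]; the lower bound remains to be matched with the existence of a
   nonzero annihilator. *)
rewrite inE gcd_lt -neq0 andbC; congr (_ && _).
apply/existsP/idP => [[y /andP[y_neq0]]|x_gt1].
  (* If [gcdn x n] were 1, then [n] would divide [gcdn y n], which lies strictly between 0 and
     [n]. *)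
  rewrite (Zp_mul_eq0 _ _ n_gt1) => n_dvd; rewrite ltnNge; apply: contraL n_dvd.
  move=> x_le1; have -> : gcdn x n = 1.
    by apply/eqP; rewrite eqn_leq x_le1 gcdn_gt0 n_gt0 orbT.
  by rewrite mul1n gtnNdvd ?gcd_lt -?neq0 // gcdn_gt0 n_gt0 orbT.
have y_lt : n %/ gcdn x n < (Zp_trunc n).+2.
  by apply: leq_trans (ltn_Pdiv x_gt1 n_gt0) _; rewrite Zp_cast.
exists (Ordinal y_lt); rewrite neq0 (Zp_mul_eq0 _ _ n_gt1) dvdn_mul_gcd /=.
rewrite divn_gt0 ?(ltnW x_gt1) // dvdn_leq ?dvdn_gcdr //=.
by rewrite -{1}(divnK (dvdn_gcdr x n)) mulnC dvdn_mul // dvdn_gcdl.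
Qed.

Theorem lemma2p7 (n : nat) (n_ge4 : (4 <= n)%N) (n_nonprime : ~~ prime n) :
  zero_divisor_graph 'Z_n =
  gjoin (upsilon n)
        (fun d : 'I_n => induced (zero_divisor_graph 'Z_n) (gcd_class n d))
        (gcd_class_disjoint n).
Proof.
have n_gt1 : 1 < n by apply: leq_trans n_ge4.
have Vzdg x := zero_divisor_graph_Zp_vertices x n_gt1.
have zdg_adj x y : adj (zero_divisor_graph 'Z_n) x y =
    [&& 1 < gcdn x n < n, 1 < gcdn y n < n, x != y
      & n %| gcdn x n * gcdn y n].
  rewrite adj_graph_of => [|a b]; last by rewrite mulrC.
  by rewrite -!Vzdg -Zp_mul_eq0.
have upsilon_adj (i j : 'I_n) := @adj_graph_of _ (vertices (upsilon n))
  (fun d e : 'I_n => n %| d * e) i j (fun d e => congr1 _ (mulnC d e)).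
have class_vertex x : 1 < gcdn x n < n ->
    exists2 i : 'I_n, i \in vertices (upsilon n) & gcdn x n = i.
  by case/andP=> gt1 lt; exists (Ordinal lt); rewrite // inE /= gt1 dvdn_gcdr.
have upsilon_vertex (i : 'I_n) : i \in vertices (upsilon n) -> 1 < i < n.
  by rewrite inE ltn_ord andbT => /andP[].
apply: sgraph_eq.
  apply/setP => x; rewrite Vzdg; apply/idP/bigcupP => [/class_vertex[i Vi xi]|].
    by exists i; rewrite // inE xi.
  by case=> i /upsilon_vertex Vi; rewrite inE => /eqP ->.
apply/setP => e; rewrite inE; apply/idP/orP => [Ee|[]]; last 2 first.
- by case/bigcupP=> i _; rewrite inE => /andP[].
- case/bigcupP=> i Vi /bigcupP[j /andP[Vj]].
  rewrite [adj _ _ _]upsilon_adj => /and4P[_ _ ij n_dvd].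
  case/imset2P=> x y; rewrite !inE => /eqP xi /eqP yj ->.
  rewrite -/(adj _ x y) zdg_adj xi yj !upsilon_vertex // n_dvd andbT /=.
  (* Equal endpoints would have equal gcds, hence equal block indices. *)
  by apply: contraNneq ij => xy; rewrite -val_eqE /= -xi -yj xy.
have /imset2P[x y _ _ exy] := Ee; move: (Ee); rewrite exy.
rewrite -/(adj _ x y) zdg_adj => /and4P[/class_vertex[i Vi xi]].
case/class_vertex=> j Vj yj xy n_dvd.
(* Endpoints with the same gcd give an edge inside one block; distinct gcds give a join edge over an
   edge of [upsilon n]. *)
have [ij|ij] := eqVneq i j; [left|right]; apply/bigcupP; exists i => //.
  by rewrite inE -{1}exy Ee subUset !sub1set !inE xi yj ij eqxx.
apply/bigcupP; exists j; last by apply: imset2_f; rewrite inE ?xi ?yj.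
by rewrite Vj [adj _ _ _]upsilon_adj Vi Vj ij -xi -yj.
Qed.
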